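(* Let $(\mathbb{X}, \|\cdot\|)$ be a finite dimensional real normed linear space of dimension at least $2$. Then the rectangular constant $\mu(\mathbb{X})$ is attained, i.e., there exist $x_0, y_0 \in \mathbb{X}\setminus\{0\}$ with $x_0 \perp_B y_0$ such that $$\mu(\mathbb{X}) = \frac{\|x_0\|+\|y_0\|}{\|x_0+y_0\|}.$$
   Context: For $x,y$ in a real normed linear space $\mathbb{X}$, $x$ is Birkhoff-James orthogonal to $y$, written $x \perp_B y$, if $\|x\| \leq \|x+\lambda y\|$ for all $\lambda \in \mathbb{R}$. For a real normed linear space $\mathbb{X}$ of dimension at least $2$, the rectangular constant is $$\mu(\mathbb{X}) = \sup\left\{ \frac{\|x\|+\|y\|}{\|x+y\|} : x, y \in \mathbb{X}\setminus\{0\},\ x \perp_B y \right\}.$$ *)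

(* Defs.v *)
From HB Require Import structures.
From mathcomp Require Import all_boot all_order all_algebra.
From mathcomp Require Import all_classical all_reals all_analysis.
Import Order.TTheory GRing.Theory Num.Theory.
Import numFieldNormedType.Exports.

Set Implicit Arguments.
Unset Strict Implicit.
Unset Printing Implicit Defensive.

Local Open Scope classical_set_scope.
Local Open Scope ring_scope.

(* Finite-dimensional normed spaces: the join makes the normed and the
   vectType structures share the same underlying R-module. *)
#[short(type="normedVectType")]
HB.structure Definition NormedVector (R : numFieldType) :=
  {V of NormedModule R V & Vector R V}.

Definition BJ_orthogonal (R : realType) (V : normedModType R) (x y : V) : Prop :=
  forall l : R, `|x| <= `|x + l *: y|.

(* The supremum is taken in \bar R, so that it has its usual meaning without
   a prior proof that the set of ratios is bounded. The denominators do not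
   vanish: BJ_orthogonal x y with l = 1 gives 0 < `|x| <= `|x + y|. *)
Definition rectangular_constant (R : realType) (V : normedModType R) : \bar R :=
  ereal_sup [set r : \bar R | exists x y : V,
    [/\ x != 0, y != 0, BJ_orthogonal x y &
        r = ((`|x| + `|y|) / `|x + y|)%:E]].

(* Main.v *)
(** Scaling makes the problem the minimisation of [`|x + y|] over orthogonal
    pairs with [`|x| + `|y| = 1].  These pairs form a compact set, since closed
    balls are compact in finite dimension, so a minimiser exists.  It may be
    degenerate ([x = 0] or [y = 0]); then the minimum is [1], so every
    nondegenerate orthogonal pair has ratio at most [1], hence exactly [1] by
    the triangle inequality, and any such pair attains the supremum.
    Nondegenerate pairs exist in dimension at least [2]: minimise
    [`|w + t *: v|] over [t] for [w] outside the line of [v]. *)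
Require Import Defs.
From mathcomp Require Import all_boot all_order all_algebra.
From mathcomp Require Import all_classical all_reals all_analysis.
From mathcomp Require Import lra.
Import Order.TTheory GRing.Theory Num.Theory.
Import numFieldNormedType.Exports.
Local Open Scope classical_set_scope.
Local Open Scope ring_scope.

Import VectorInternalTheory.

(** Being linear, the map is a finite sum of coordinate functions times fixed vectors, and each
    coordinate is continuous. *)
Lemma r2v_continuous (R : realType) (V : normedVectType R) :
  continuous (r2v : 'rV[R]_(dim V) -> V).
Proof.
have -> : (r2v : 'rV[R]_(dim V) -> V) =
    fun u => \sum_i u 0 i *: (r2v (delta_mx 0 i) : V).
  apply/funext => u; rewrite {1}(row_sum_delta u) linear_sum.
  by apply: eq_bigr => i _; rewrite linearZ.
move=> u; apply: (@cvg_big _ _ _ _ _ _ _ (nbhs u)) => [|i _].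
  exact: add_continuous.
by apply: cvgZr_tmp; exact: coord_continuous.
Qed.

Lemma norm_r2v_continuous (R : realType) (V : normedVectType R) :
  continuous (fun u : 'rV[R]_(dim V) => `|r2v u : V|).
Proof.
move=> u; apply: (@cvg_norm _ _ _ (nbhs u)); exact: r2v_continuous.
Qed.

(** The constant is the minimum of [|r2v u|] over the compact unit sphere [S] of the coordinate
    space. Injectivity of [r2v] makes it positive, and homogeneity carries the bound to all [u]. *)
Lemma r2v_norm_lb (R : realType) (V : normedVectType R) :
  exists2 c : R, 0 < c & forall u : 'rV[R]_(dim V), c * `|u| <= `|r2v u : V|.
Proof.
pose S := [set u : 'rV[R]_(dim V) | `|u| = 1].
have normalize (u : 'rV[R]_(dim V)) : u != 0 -> S (`|u|^-1 *: u).
  move=> u0; have nu0 : `|u| != 0 by rewrite normr_eq0.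
  by rewrite /S /= normrZ normfV normr_id mulVf.
(* If [S] is empty, every [u] is zero and any positive constant will do. *)
have [[u0 Su0]|S0] := pselect (S !=set0); last first.
  exists 1 => // u; have [->|/normalize Su] := eqVneq u 0.
    by rewrite normr0 mulr0.
  by exfalso; apply: S0; exists (`|u|^-1 *: u).
have cS : compact S.
  apply: bounded_closed_compact.
    by exists 1; split => // x x1 u; rewrite /S /= => ->; exact: ltW.
  apply: (@preimage_closed _ _ (Num.Def.normr : 'rV[R]_(dim V) -> R) [set 1]).
    by move=> u _; exact: norm_continuous.
  exact: closed_eq.
have [||c /set_mem Sc cmin] :=
    @compact_EVT_min _ R (fun u : 'rV[R]_(dim V) => `|r2v u : V|) S _ cS.
- by exists u0.
- by apply: continuous_subspaceT; exact: norm_r2v_continuous.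
exists `|r2v c : V|.
  rewrite normr_gt0; apply/eqP => c0.
  have : c = 0 by apply: r2v_inj; rewrite c0 linear0.
  by move=> c00; move: Sc; rewrite /S /= c00 normr0 => /esym/eqP; rewrite oner_eq0.
move=> u; have [->|nzu] := eqVneq u 0; first by rewrite normr0 mulr0.
have nu0 : 0 < `|u| by rewrite normr_gt0.
have := cmin _ (mem_set (normalize _ nzu)).
rewrite linearZ /= normrZ normfV normr_id mulrC.
by rewrite ler_pdivlMr.
Qed.

(** The ball is the continuous image of its set of coordinates, which is closed, and bounded by
    [r / c] thanks to [r2v_norm_lb]. *)
Lemma norm_le_compact (R : realType) (V : normedVectType R) (r : R) :
  compact [set v : V | `|v| <= r].
Proof.
have [c c0 cle] := r2v_norm_lb R V.
pose A := [set u : 'rV[R]_(dim V) | `|r2v u : V| <= r].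
have -> : [set v : V | `|v| <= r] = (r2v : 'rV[R]_(dim V) -> V) @` A.
  apply/seteqP; split => [v vr|_ [u Au <-]//].
  by exists (v2r v); rewrite ?/A /= v2rK.
apply: continuous_compact.
  apply: continuous_subspaceT; exact: r2v_continuous.
apply: bounded_closed_compact.
  exists (r / c); split => [|x rcx u]; first exact: num_real.
  rewrite /A /= => ur; apply: le_trans (ltW rcx).
  by rewrite ler_pdivlMr// mulrC (le_trans (cle u)).
apply: (@preimage_closed _ _ (fun u : 'rV[R]_(dim V) => `|r2v u : V|)
  [set x | x <= r]).
  by move=> u _; exact: norm_r2v_continuous.
exact: closed_le.
Qed.

(** A global minimiser [t] of [|w + t *: v|] works. The choice of [M] gives [|t *: v| > 2 * |w|]
    once [|t| > M], so the norm there exceeds its value [|w|] at [0], and minimising over [[- M, M]]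
    suffices. *)
Lemma BJ_orthogonal_exists (R : realType) (V : normedModType R) (v w : V) :
  v != 0 -> exists t : R, BJ_orthogonal (w + t *: v) v.
Proof.
move=> v0; have nv0 : 0 < `|v| by rewrite normr_gt0.
pose f (t : R) : R := `|w + t *: v|.
pose M := 2 * `|w| / `|v|.
have M0 : 0 <= M by rewrite divr_ge0 ?mulr_ge0.
have [||c _ cmin] := @EVT_min R f (- M) M.
- by rewrite ge0_cp.
- apply: continuous_subspaceT => t; apply: cvg_norm.
  by apply: cvgD; [exact: cvg_cst|apply: cvgZr_tmp; exact: cvg_id].
exists c => l; rewrite -addrA -scalerDl -/(f c) -/(f (c + l)).
have [cl|cl] := leP `|c + l| M.
  by apply: cmin; rewrite in_itv /= -ler_norml.
apply: (@le_trans _ _ (f 0)); first by apply: cmin; rewrite in_itv /= oppr_le0 M0.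
rewrite /f scale0r addr0.
have : 2 * `|w| < `|(c + l) *: v| by rewrite normrZ -ltr_pdivrMr.
have := ler_normB (w + (c + l) *: v) w; rewrite addrAC subrr add0r.
lra.
Qed.

Lemma BJ_orthogonalZ (R : realType) (V : normedModType R) (k : R) (x y : V) :
  BJ_orthogonal x y -> BJ_orthogonal (k *: x) (k *: y).
Proof.
move=> xy l; rewrite scalerA mulrC -scalerA -scalerDr !normrZ.
by rewrite ler_wpM2l.
Qed.

(** The bound is homogeneous in [(x, y)], so minimality over normalised pairs yields it for every
    orthogonal pair, without division and including the zero pair. *)
Lemma BJ_orthogonal_min_pair (R : realType) (V : normedVectType R) :
  (exists v : V, v != 0) ->
  exists x0 y0 : V, [/\ BJ_orthogonal x0 y0, `|x0| + `|y0| = 1 &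
    forall x y : V, BJ_orthogonal x y ->
      `|x0 + y0| * (`|x| + `|y|) <= `|x + y|].
Proof.
move=> [v v0].
pose B := [set x : V | `|x| <= 1].
pose N := [set p : V * V | `|p.1| + `|p.2| = 1].
pose O := [set p : V * V | BJ_orthogonal p.1 p.2].
have norm1 : continuous (fun p : V * V => `|p.1|).
  by move=> p; apply: (@cvg_norm _ _ _ (nbhs p)); exact: cvg_fst.
have norm2 : continuous (fun p : V * V => `|p.2|).
  by move=> p; apply: (@cvg_norm _ _ _ (nbhs p)); exact: cvg_snd.
have normD l : continuous (fun p : V * V => `|p.1 + l *: p.2|).
  move=> p; apply: (@cvg_norm _ _ _ (nbhs p)).
  apply: (@cvgD _ _ _ (nbhs p)); first exact: cvg_fst.
  by apply: (@cvgZl_tmp _ _ _ (nbhs p)); exact: cvg_snd.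
have cN : closed N.
  apply: (@preimage_closed _ _ (fun p : V * V => `|p.1| + `|p.2|) [set 1]).
    by move=> p _; apply: (@cvgD _ _ _ (nbhs p)); [exact: norm1|exact: norm2].
  exact: closed_eq.
have cO : closed O.
  (* For fixed [l] the defining inequality is a closed condition on the pair, so [O] is an
     intersection of closed sets. *)
  have -> : O = \bigcap_(l in [set: R])
      [set p : V * V | `|p.1| - `|p.1 + l *: p.2| <= 0].
    apply/seteqP; split => [p Op l _|p Op l] /=; first by rewrite subr_le0.
    by rewrite -subr_le0; exact: Op.
  apply: closed_bigI => l _.
  apply: (@preimage_closed _ _
    (fun p : V * V => `|p.1| - `|p.1 + l *: p.2|) [set x | x <= 0]).
    by move=> p _; apply: (@cvgB _ _ _ (nbhs p)); [exact: norm1|exact: normD].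
  exact: closed_le.
have cK : compact (N `&` O).
  apply: (@subclosed_compact _ _ (B `*` B)).
  - exact: closedI.
  - by apply: compact_setX; exact: norm_le_compact.
  - move=> p [Np _]; have := normr_ge0 p.1; have := normr_ge0 p.2.
    by rewrite /N /= in Np; split; rewrite /B /=; lra.
have nz (x y : V) : (x, y) != 0 -> `|x| + `|y| != 0.
  apply: contra; rewrite paddr_eq0// !normr_eq0 => /andP[/eqP -> /eqP ->].
  by [].
have NZ (x y : V) : (x, y) != 0 -> BJ_orthogonal x y ->
    (N `&` O) ((`|x| + `|y|)^-1 *: x, (`|x| + `|y|)^-1 *: y).
  move=> xy0 xy; split; last exact: BJ_orthogonalZ.
  rewrite /N /= !normrZ -mulrDr ger0_norm ?invr_ge0 ?addr_ge0// mulVf//.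
  exact: nz.
have [||[x0 y0] /set_mem [/= Np Op] cmin] :=
    @compact_EVT_min _ R (fun p : V * V => `|p.1 + p.2|) (N `&` O) _ cK.
(* The zero vector is orthogonal to everything, so normalising [(0, v)] shows that the set is
   nonempty. *)
- eexists; apply: (NZ 0 v) => [|l]; last by rewrite normr0.
  by apply: contra v0 => /eqP[->].
- apply: continuous_subspaceT.
  by under eq_fun do rewrite -[X in _ + X]scale1r; exact: normD.
exists x0, y0; split => // x y xy.
have [[-> ->]|xy0] := eqVneq (x, y) 0; first by rewrite !(normr0, addr0, mulr0).
have := cmin _ (mem_set (NZ _ _ xy0 xy)).
rewrite /= -scalerDr normrZ ger0_norm ?invr_ge0 ?addr_ge0//.
rewrite mulrC ler_pdivlMr// lt_neqAle addr_ge0// andbT eq_sym.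
exact: nz.
Qed.

(** The comparison of ratios is cross-multiplied, and [(x0, y0)] is not assumed normalised, so that
    both the minimiser and an arbitrary nondegenerate pair can be used. *)
Lemma rectangular_constant_attained (R : realType) (V : normedModType R)
    (x0 y0 : V) : x0 != 0 -> y0 != 0 -> BJ_orthogonal x0 y0 ->
  (forall x y : V, BJ_orthogonal x y ->
    `|x0 + y0| * (`|x| + `|y|) <= `|x + y| * (`|x0| + `|y0|)) ->
  rectangular_constant V = ((`|x0| + `|y0|) / `|x0 + y0|)%:E.
Proof.
have pos (x y : V) : x != 0 -> BJ_orthogonal x y -> 0 < `|x + y|.
  move=> x0' /(_ 1); rewrite scale1r; apply: lt_le_trans.
  by rewrite normr_gt0.
move=> nx0 ny0 xy0 min0; apply/eqP; rewrite eq_le; apply/andP; split.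
  apply: ge_ereal_sup => _ [x [y [nx ny xy ->]]]; rewrite lee_fin.
  rewrite ler_pdivrMr ?pos// mulrAC ler_pdivlMr ?pos// mulrC.
  by rewrite (mulrC (_ + _) `|x + y|) min0.
by apply: ereal_sup_ubound; exists x0, y0; split.
Qed.

Theorem theorem2p2 (R : realType) (V : normedVectType R)
    (dimV : (2 <= \dim {:V})%N) :
  exists x0 y0 : V,
    [/\ x0 != 0, y0 != 0, BJ_orthogonal x0 y0 &
        rectangular_constant V = ((`|x0| + `|y0|) / `|x0 + y0|)%:E].
Proof.
have [a [b [na nb ab]]] : exists a b : V, [/\ a != 0, b != 0 & BJ_orthogonal a b].
  pose v : V := vpick {:V}.
  have v0 : v != 0.
    by rewrite vpick0 -dimv_eq0; case: (\dim _) dimV.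
  have [w wv] : exists w : V, w \notin <[v]>%VS.
    have /subvPn[w _ wv] : ~~ ({:V} <= <[v]>)%VS.
      by apply/negP => /dimvS; rewrite dim_vline v0 leqNgt dimV.
    by exists w.
  have [t tv] := BJ_orthogonal_exists R V v w v0.
  exists (w + t *: v), v; split => //.
  (* If [w + t *: v] vanished, [w] would lie on the line of [v]. *)
  apply: contra wv; rewrite addr_eq0 -scaleNr => /eqP ->.
  by apply/vlineP; exists (- t).
have [|x [y [xy n1 xymin]]] := BJ_orthogonal_min_pair R V; first by exists a.
have [xy0|] := boolP ((x == 0) || (y == 0)).
  have m1 : `|x + y| = 1.
    by case/orP: xy0 n1 => /eqP ->; rewrite normr0 ?add0r ?addr0.
  exists a, b; split => //; apply: rectangular_constant_attained => // c d cd.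
  have := xymin _ _ cd; rewrite m1 mul1r => le1.
  (* Multiply the triangle inequality for [(a, b)] by [le1], the reverse inequality for [(c, d)]. *)
  by rewrite [leRHS]mulrC ler_pM ?addr_ge0// ler_normD.
rewrite negb_or => /andP[nx ny]; exists x, y; split => //.
by apply: rectangular_constant_attained => // c d cd; rewrite n1 mulr1 xymin.
Qed.
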